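(* Let $p\ge 1$ be an integer and $q\ge 4$ an even integer. If $H$ is a graph that is $L$-cospectral to the jellyfish graph $JFG(p,q)$, then $H$ is DLS.
   Context: All graphs are finite and simple. The jellyfish graph $JFG(p,q)$ is obtained from a cycle $C_q$ and $q$ copies of the star $K_{1,p}$ by identifying each vertex of $C_q$ with the center (vertex of maximum degree) of a distinct copy of $K_{1,p}$. The Laplacian matrix of a graph is $L(G)=D(G)-A(G)$, where $A(G)$ is the adjacency matrix and $D(G)$ the diagonal degree matrix. Two graphs are $L$-cospectral if their Laplacian matrices have the same spectrum. A graph is DLS (determined by its Laplacian spectrum) if every graph $L$-cospectral with it is isomorphic to it. *)

(* Defs.v *)
From mathcomp Require Import all_boot all_order all_algebra.
Set Implicit Arguments. Unset Strict Implicit. Unset Printing Implicit Defensive.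
Import GRing.Theory Num.Theory.

Definition simple_graph (n : nat) (e : rel 'I_n) : Prop :=
  symmetric e /\ irreflexive e.

Definition laplacian (n : nat) (e : rel 'I_n) : 'M[int]_n :=
  \matrix_(i, j) ((#|[set k | e i k]|%:Z *+ (i == j)) - (e i j)%:Z)%R.

(* L-cospectral: Laplacian matrices have the same spectrum (with multiplicities),
   i.e. the same characteristic polynomial. *)
Definition L_cospectral (n m : nat) (e : rel 'I_n) (f : rel 'I_m) : Prop :=
  char_poly (laplacian e) = char_poly (laplacian f).

Definition graph_iso (n m : nat) (e : rel 'I_n) (f : rel 'I_m) : Prop :=
  exists g : 'I_n -> 'I_m, bijective g /\ forall i j, f (g i) (g j) = e i j.

Definition DLS (n : nat) (e : rel 'I_n) : Prop :=
  forall (m : nat) (f : rel 'I_m), simple_graph f -> L_cospectral f e -> graph_iso f e.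

(* Jellyfish graph JFG(p,q) on q*(p+1) vertices: vertex v belongs to block
   c = v %/ (p+1); if v %% (p+1) = 0 it is the cycle vertex (star center) of
   block c, otherwise it is a pendant (leaf) of the star centered there.
   Cycle vertices c and c' are adjacent iff c' = c+1 mod q or c = c'+1 mod q. *)
Definition jfg_rel (p q : nat) : rel 'I_(q * p.+1) :=
  fun u v =>
    let cu := (u %/ p.+1)%N in let cv := (v %/ p.+1)%N in
    let ku := (u %% p.+1)%N in let kv := (v %% p.+1)%N in
    [|| [&& ku == 0%N, kv == 0%N & ((cv == cu.+1 %% q) || (cu == cv.+1 %% q))],
        [&& ku == 0%N, kv != 0%N & cu == cv]
      | [&& ku != 0%N, kv == 0%N & cu == cv]].
Arguments jfg_rel : clear implicits.

(* Main.v *)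
(* Coefficient 1 of the Laplacian characteristic polynomial is, up to sign, n times
   the number of spanning trees, and the trace of L is the degree sum; so a cospectral mate
   h is connected with as many edges as vertices, i.e. unicyclic, and its cycle has length q.
   Orienting its edges towards and then along the cycle presents h as the graph of a self-map f,
   with L = B^T B for B = 1 - P_f; this is also how the jellyfish graph itself is treated.
   As q >= 4 there are no triangles, so the traces of L, L^2 and L^3 determine the sum of
   (d - 1)(d - (p + 2))^2 over the degrees d; this sum vanishes for the jellyfish graph, hence all
   degrees of h are 1 or p + 2.  Every cycle vertex then has degree p + 2, and counting edges
   shows that all other vertices are leaves attached to the cycle. *)
Require Import Defs.
From mathcomp Require Import all_boot all_order all_algebra all_field.
From mathcomp Require Import spectral ring zify.
Set Implicit Arguments. Unset Strict Implicit. Unset Printing Implicit Defensive.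
Import Order.TTheory GRing.Theory Num.Theory.
Local Open Scope ring_scope.

(** * Determinants, cofactors and characteristic polynomials *)

Lemma det_1_addmx (R : comNzRingType) n (u : 'cV[R]_n) (v : 'rV[R]_n) :
  \det (1%:M + u *m v) = 1 + (v *m u) 0 0.
Proof.
(* The outer factors are unitriangular, so comparing determinants of the two block-triangular
   matrices gives the rank-one formula. *)
have E : block_mx 1%:M 0 v 1%:M *m block_mx (1%:M + u *m v) u 0 1%:M
    *m block_mx 1%:M 0 (- v) 1%:M = block_mx 1%:M u 0 (1%:M + v *m u).
  rewrite !mulmx_block !mul1mx !mul0mx !mulmx0 !mulmx1 !addr0 !add0r.
  rewrite mulmxN mulmxN addrK mulmxDr mulmx1 mulmxDl mul1mx mulmxA.
  by congr block_mx; rewrite 1?[v + _]addrC ?subrr // addrC.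
have := congr1 determinant E.
rewrite !det_mulmx !det_lblock !det_ublock !det1 !mul1r !mulr1 => ->.
by rewrite det_mx11 !mxE eqxx.
Qed.

(* Coefficient 1 of [(X - A) * adj (X - A) = char_poly A], multiplied on the left by [x]. *)
Lemma coef1_char_poly (R : comNzRingType) n (A : 'M[R]_n) (x : 'rV[R]_n) :
  x *m A = 0 -> (char_poly A)`_1 *: x = x *m \adj (- A).
Proof.
move=> xA; pose Adj := \adj (char_poly_mx A).
have adj0 : \adj (- A) = map_mx (horner_eval 0) Adj.
  rewrite map_mx_adj; congr (\adj _); apply/matrixP=> i j.
  by rewrite /char_poly_mx !mxE /= /horner_eval hornerD hornerN hornerMn hornerX hornerC mul0rn add0r.
have E : ((char_poly A)`_1)%:M = \adj (- A) - A *m map_mx (coefp 1) Adj.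
  apply/matrixP=> i k; rewrite adj0 !mxE /= /horner_eval horner_coef0.
  have := congr1 (fun M : 'M[{poly R}]_n => (M i k)`_1) (mul_mx_adj (char_poly_mx A)).
  rewrite !mxE coefMn -/(char_poly A) => <-.
  transitivity (\sum_j ((i == j)%:R * (Adj j k)`_0 - A i j * (Adj j k)`_1)).
    rewrite coef_sum; apply: eq_bigr => j _; rewrite !mxE mulrBl coefB coefCM.
    by case: (i == j); rewrite ?mulr1n ?mulr0n ?mul1r ?mul0r ?coef0 // coefXM.
  rewrite big_split /= sumrN (bigD1 i) //= eqxx mul1r big1 ?addr0; last first.
    by move=> j; rewrite eq_sym => /negPf ->; rewrite mul0r.
  by congr (_ - _); [rewrite mxE | apply: eq_bigr => j _; rewrite [in RHS]mxE].
rewrite -mul_mx_scalar E mulmxBr mulmxA xA mul0mx subr0 //.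
Qed.

Lemma cofactor_opp (R : comNzRingType) n (A : 'M[R]_n) i j :
  cofactor (- A) i j = (-1) ^+ n.-1 * cofactor A i j.
Proof.
rewrite /cofactor mulrCA; congr (_ * _); rewrite -detZ; congr determinant.
by apply/matrixP=> k l; rewrite !mxE mulN1r.
Qed.

(** Dropping the zero entry [k] of [y] leaves a nonzero left kernel vector of every minor that omits
    row [k]. *)
Lemma cofactor_kernel0 (R : idomainType) n (A : 'M[R]_n) (y : 'rV[R]_n) k :
  y *m A = 0 -> y != 0 -> y 0 k = 0 -> forall i, cofactor A k i = 0.
Proof.
move=> yA y0 yk i; apply/eqP; rewrite mulf_eq0 signr_eq0 /=; apply/det0P.
exists (col' k y).
  apply: contraNneq y0 => /rowP y0; apply/eqP/rowP=> j; rewrite mxE.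
  by case: (unliftP k j) => [l ->|->//]; have := y0 l; rewrite !mxE.
apply/rowP=> l; have /rowP/(_ (lift i l)) := yA; rewrite !mxE => E.
transitivity (\sum_j y 0 j * A j (lift i l)); last exact: E.
rewrite [RHS](bigD1_ord k) //= yk mul0r add0r.
by apply: eq_bigr => j _; rewrite !mxE.
Qed.

Lemma det_add_delta (R : comNzRingType) n (A : 'M[R]_n) a :
  \det (A + delta_mx a a) = \det A + cofactor A a a.
Proof.
have cof j : cofactor (A + delta_mx a a) a j = cofactor A a j.
  rewrite /cofactor; congr (_ * \det _); apply/matrixP=> k l; rewrite !mxE.
  by rewrite eq_sym (negPf (neq_lift _ _)) addr0.
rewrite (expand_det_row _ a) (expand_det_row A a).
transitivity (\sum_j (A a j * cofactor A a j + (j == a)%:R * cofactor A a j)).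
  by apply: eq_bigr => j _; rewrite cof !mxE eqxx /= mulrDl.
rewrite big_split /=; congr (_ + _); rewrite (bigD1 a) //= eqxx mul1r big1 ?addr0 //.
by move=> j /negPf ->; rewrite mul0r.
Qed.

Lemma char_poly_conj (R : comUnitRingType) n (P D : 'M[R]_n) :
  P \in unitmx -> char_poly (invmx P *m D *m P) = char_poly D.
Proof.
move=> uP; rewrite /char_poly /char_poly_mx.
have -> : 'X%:M - map_mx polyC (invmx P *m D *m P) =
   map_mx polyC (invmx P) *m ('X%:M - map_mx polyC D) *m map_mx polyC P.
  rewrite !map_mxM mulmxBr mulmxBl; congr (_ - _).
  rewrite scalar_mxC -mulmxA -map_mxM mulVmx // map_mx1 mulmx1 //.
rewrite !det_mulmx mulrAC -det_mulmx -map_mxM mulVmx // map_mx1 det1 mul1r //.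
Qed.

(** * Traces of powers as spectral invariants *)

Section PowerSums.
Variables (n : nat).
Implicit Types A B : 'M[int]_n.

Let complexify A : 'M[algC]_n := map_mx (intr : int -> algC) A.

(** Over [algC] the matrix is normal, so the spectral theorem conjugates it to a diagonal matrix;
    traces of powers become power sums of the eigenvalues. *)
Lemma symmetric_spectrum A : A^T = A -> exists d : 'rV[algC]_n,
  [/\ map_poly (intr : int -> algC) (char_poly A) = \prod_i ('X - (d 0 i)%:P),
      (\tr A)%:~R = \sum_i d 0 i,
      (\tr (A *m A))%:~R = \sum_i d 0 i ^+ 2 &
      (\tr (A *m A *m A))%:~R = \sum_i d 0 i ^+ 3].
Proof.
move=> sA; pose C := complexify A.
have nC : C \is normalmx.
  apply: symmetric_normalmx; last by apply/mxOverP => i j; rewrite mxE Rreal_int // rpred_int.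
  by apply/is_hermitianmxP; rewrite expr0 scale1r map_mx_id // /C /complexify map_trmx sA.
move/orthomx_spectralP: nC; set P := spectralmx _; set d := spectral_diag _ => CE.
have uP : P \in unitmx by apply: unitarymx_unit; apply: spectral_unitarymx.
exists d.
have trM M : (\tr M)%:~R = \tr (complexify M).
  by rewrite /mxtrace rmorph_sum; apply: eq_bigr => i _; rewrite mxE.
have cM M N : complexify (M *m N) = complexify M *m complexify N by apply: map_mxM.
have conjM (D E : 'M_n) : invmx P *m D *m P *m (invmx P *m E *m P) = invmx P *m (D *m E) *m P.
  by rewrite -!mulmxA; do 2!congr (_ *m _); rewrite !mulmxA mulmxV // mul1mx.
have trc (D : 'M_n) : \tr (invmx P *m D *m P) = \tr D.
  by rewrite mxtrace_mulC mulmxA mulmxV // mul1mx.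
split.
- rewrite map_char_poly -/(complexify A) -/C CE char_poly_conj // char_poly_trig.
    by apply: eq_bigr => i _; rewrite mxE eqxx mulr1n.
  exact: diag_mx_is_trig.
- by rewrite trM -/C CE trc mxtrace_diag.
- rewrite trM cM -/C CE conjM trc mulmx_diag mxtrace_diag.
  by apply: eq_bigr => i _; rewrite mxE expr2.
- rewrite trM !cM -/C CE !conjM trc !mulmx_diag mxtrace_diag.
  by apply: eq_bigr => i _; rewrite !mxE !exprSr expr0 mul1r.
Qed.

Lemma cospectral_traces A B : A^T = A -> B^T = B -> char_poly A = char_poly B ->
  [/\ \tr A = \tr B, \tr (A *m A) = \tr (B *m B) &
      \tr (A *m A *m A) = \tr (B *m B *m B)].
Proof.
move=> /symmetric_spectrum[d [dP d1 d2 d3]] /symmetric_spectrum[e [eP e1 e2 e3]] AB.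
have pe : perm_eq [seq d 0 i | i <- enum 'I_n] [seq e 0 i | i <- enum 'I_n].
  by apply: prod_XsubC_eq; rewrite !big_image /= -dP -eP AB.
have sum_eq (F : algC -> algC) : \sum_i F (d 0 i) = \sum_i F (e 0 i).
  transitivity (\sum_(x <- [seq d 0 i | i <- enum 'I_n]) F x); first by rewrite big_image.
  by rewrite (perm_big _ pe) big_image.
by split; apply: (@intr_inj algC); rewrite ?d1 ?d2 ?d3 ?e1 ?e2 ?e3;
  [apply: (sum_eq id) | apply: (sum_eq (fun x => x ^+ 2)) | apply: (sum_eq (fun x => x ^+ 3))].
Qed.

End PowerSums.

(** * Kernel and power traces of the Laplacian *)

Lemma laplacian_sym n (h : rel 'I_n) : symmetric h -> (laplacian h)^T = laplacian h.
Proof.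
move=> sh; apply/matrixP=> i j; rewrite !mxE sh eq_sym.
by case: eqP => [->|].
Qed.

Lemma sum_rel (n : nat) (e : rel 'I_n) i : \sum_j (e i j)%:Z = #|[set k | e i k]|%:Z.
Proof.
rewrite -sum1dep_card (big_morph Posz PoszD (erefl _)) [RHS]big_mkcond; apply: eq_bigr => j _.
by case: (e i j).
Qed.

(** Applied to the all-ones vector and to indicators of connected components and their
    complements. *)
Lemma laplacian_kernel n (h : rel 'I_n) (x : 'rV[int]_n) : symmetric h ->
  (forall i j, h i j -> x 0 i = x 0 j) -> x *m laplacian h = 0.
Proof.
move=> sh xh; apply/rowP=> j; rewrite !mxE.
transitivity (\sum_i (x 0 j * (#|[set k | h j k]|%:Z *+ (i == j)) - x 0 j * (h j i)%:Z)).
  apply: eq_bigr => i _; rewrite !mxE mulrBr sh.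
  congr (_ - _); first by case: eqP => [->//|_]; rewrite !mulr0n !mulr0.
  by case hij: (h j i); rewrite ?mulr0 // (xh j i hij).
rewrite sumrB -!mulr_sumr sum_rel (bigD1 j) //= eqxx big1 ?addr0 ?subrr //.
by move=> i /negPf ->.
Qed.

Lemma laplacian_trace n (h : rel 'I_n) : irreflexive h ->
  \tr (laplacian h) = \sum_i #|[set k | h i k]|%:Z.
Proof. by move=> ih; apply: eq_bigr => i _; rewrite mxE eqxx ih subr0. Qed.

Definition adjacency n (h : rel 'I_n) : 'M[int]_n := \matrix_(i, j) (h i j)%:Z.

Section LaplacianPowers.
Variables (n : nat) (h : rel 'I_n).
Hypothesis sgh : simple_graph h.

Let d i : int := #|[set k | h i k]|%:Z.
Let D : 'M[int]_n := diag_mx (\row_i d i).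
Let A := adjacency h.

Let LDA : laplacian h = D - A.
Proof. by apply/matrixP=> i j; rewrite !mxE; case: eqP => [->|]. Qed.

Let AA i : (A *m A) i i = d i.
Proof.
rewrite mxE /d -sum_rel; apply: eq_bigr => j _; rewrite !mxE (sgh.1 j i).
by case: (h i j).
Qed.

Let trDA e : \tr (diag_mx e *m A) = 0.
Proof.
rewrite /mxtrace big1 // => i _; rewrite mul_diag_mx !mxE sgh.2 mulr0 //.
Qed.

Lemma laplacian_trace2 : \tr (laplacian h *m laplacian h) = \sum_i (d i ^+ 2 + d i).
Proof.
rewrite LDA mulmxBl !mulmxBr !raddfB /= [\tr (A *m D)]mxtrace_mulC trDA.
rewrite subr0 sub0r opprK big_split /= mulmx_diag mxtrace_diag.
congr (_ + _); last by apply: eq_bigr => i _; rewrite AA.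
by apply: eq_bigr => i _; rewrite !mxE expr2.
Qed.

(** Expand [(D - A)^3]. Up to cyclic rotation the words with two factors [D] have trace 0, as [A]
    has zero diagonal, and each of the three words with one [D] contributes the sum of the squared
    degrees. *)
Lemma laplacian_trace3 :
  \tr (laplacian h *m laplacian h *m laplacian h) =
  \sum_i (d i ^+ 3 + 3 * d i ^+ 2) - \tr (A *m A *m A).
Proof.
have DAA : \tr (D *m (A *m A)) = \sum_i d i ^+ 2.
  by apply: eq_bigr => i _; rewrite mul_diag_mx mxE AA mxE expr2.
have DDA : \tr (D *m D *m A) = 0 by rewrite mulmx_diag trDA.
have DDD : \tr (D *m D *m D) = \sum_i d i ^+ 3.
  rewrite !mulmx_diag mxtrace_diag; apply: eq_bigr => i _.
  by rewrite !mxE !exprSr expr0 mul1r.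
rewrite LDA !(mulmxBl, mulmxBr) !raddfB /= DDD DDA.
rewrite [\tr (A *m D *m D)]mxtrace_mulC mulmxA [\tr (D *m A *m D)]mxtrace_mulC mulmxA DDA.
rewrite [\tr (A *m A *m D)]mxtrace_mulC [\tr (A *m D *m A)]mxtrace_mulC.
rewrite [A *m (A *m D)]mulmxA [\tr (A *m A *m D)]mxtrace_mulC -[D *m A *m A]mulmxA DAA.
by rewrite big_split /= -mulr_sumr; ring.
Qed.

End LaplacianPowers.

(** * Graphs presented by a self-map *)

Lemma int_square_unit (x y : int) : x * y = 1 -> x ^+ 2 = 1.
Proof. by move/(congr1 absz); rewrite abszM => /eqP; rewrite muln_eq1 => /andP[/eqP]; lia. Qed.

(** Each vertex [u] owns the edge from [u] to [f u]. The last two conditions exclude loops and an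
    edge owned by both of its ends, so there are exactly [n] edges. *)
Definition functional n (h : rel 'I_n) (f : 'I_n -> 'I_n) :=
  [/\ forall u v, h u v = (v == f u) || (u == f v),
      forall u, f u != u & forall u, f (f u) != u].

Definition indeg n (f : 'I_n -> 'I_n) v := #|[set w | f w == v]|.

Lemma sum_indeg n (f : 'I_n -> 'I_n) : (\sum_v indeg f v = n)%N.
Proof.
rewrite -[RHS]card_ord -sum1_card [RHS](partition_big f predT) //=.
by apply: eq_bigr => v _; rewrite /indeg -sum1dep_card.
Qed.

Section Functional.
Variables (n : nat) (h : rel 'I_n) (f : 'I_n -> 'I_n).
Hypothesis hf : functional h f.

Lemma functional_simple : simple_graph h.
Proof.
have [hE f1 _] := hf; split=> [u v|u]; first by rewrite !hE orbC.
by rewrite hE orbb eq_sym (negPf (f1 u)).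
Qed.

Lemma functional_deg v : #|[set k | h v k]| = (indeg f v).+1.
Proof.
have [hE f1 f2] := hf.
have -> : [set k | h v k] = f v |: [set w | f w == v].
  by apply/setP=> w; rewrite !inE hE [v == _]eq_sym.
by rewrite cardsU1 inE f2.
Qed.

Lemma functional_tracesum : \sum_v #|[set k | h v k]|%:Z = (n.*2)%:Z.
Proof.
under eq_bigr => v _ do rewrite functional_deg.
rewrite -(big_morph Posz PoszD (erefl _)); congr Posz.
under eq_bigr => v _ do rewrite -add1n.
by rewrite big_split /= sum1_card card_ord sum_indeg addnn.
Qed.

(** Orient the edges of a triangle by [f]. A cyclic orientation gives a point with
    [f (f (f u)) = u]; otherwise some vertex has two outgoing edges, whose ends coincide, and the
    third edge is a loop. *)
Lemma functional_trianglefree : (forall u, f (f (f u)) != u) ->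
  \tr (adjacency h *m adjacency h *m adjacency h) = 0.
Proof.
have [hE f1 f2] := hf => f3.
rewrite /mxtrace big1 // => i _; rewrite mxE big1 // => k _.
rewrite mxE mulr_suml big1 // => j _; rewrite !mxE !hE.
have f1' u : f u <> u by apply/eqP.
have f3' u : f (f (f u)) <> u by apply/eqP.
have [Ei Ej Ek Fi] := And4 (f1' i) (f1' j) (f1' k) (f3' i).
do ![case: eqP => ?]; rewrite ?mul0r ?mulr0 //=; exfalso; congruence.
Qed.

End Functional.

(** * Coefficient 1 of the characteristic polynomial and the cycle length *)

Lemma laplacian_det0 n (h : rel 'I_n) (a : 'I_n) : symmetric h -> \det (laplacian h) = 0.
Proof.
move=> sh; apply/eqP/det0P; exists (const_mx 1).
  by apply/eqP=> /rowP/(_ a); rewrite !mxE.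
by apply: laplacian_kernel => // i j; rewrite !mxE.
Qed.

(** Taking [v := f a] shows that [a] is periodic; the orbit of [a] is then the only cycle of [f]. *)
Definition reaches n (f : 'I_n -> 'I_n) a := forall v, exists m, iter m f v == a.

Section CycleLength.
Variables (n : nat) (h : rel 'I_n) (f : 'I_n -> 'I_n) (a : 'I_n).
Hypotheses (hf : functional h f) (fa : reaches f a).

Let d v := ex_minn (fa v).

Let d0 : d a = 0%N.
Proof. by rewrite /d; case: ex_minnP => m _ /(_ 0%N); rewrite eqxx leqn0 => /(_ isT)/eqP. Qed.

Let dS v : v != a -> d v = (d (f v)).+1.
Proof.
rewrite /d => va; case: ex_minnP => -[|m]; first by rewrite (negPf va).
rewrite iterSr => mv m_min; case: ex_minnP => k kv k_min.
by apply/eqP; rewrite eqn_leq m_min ?iterSr //= ltnS k_min.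
Qed.

Lemma reached_periodic : iter (order f a) f a = a.
Proof.
have [m /eqP Em] := fa (f a); apply/(orbitPcycle 3 4).
by exists m; rewrite iterSr.
Qed.

Let d_fa : d (f a) = (order f a).-1.
Proof.
rewrite /d; case: ex_minnP => m; rewrite -iterSr => /eqP Em m_min.
apply/eqP; rewrite eqn_leq m_min; last by rewrite -iterSr prednK ?order_gt0 // reached_periodic.
rewrite -ltnS prednK ?order_gt0 // leqNgt; apply/negP => /findex_iter.
by rewrite Em findex0.
Qed.

Let path_to v := traject f v (d v).+1.

(** Starting just after [a], the path back to [a] runs exactly once around the cycle. *)
Let path_fa : perm_eq (path_to (f a)) (orbit f a).
Proof.
have := reached_periodic; rewrite /path_to d_fa /orbit.
case: (order f a) (order_gt0 f a) => // k _ Ek.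
by rewrite -[k.+1.-1]/k trajectSr -iterSr Ek trajectS perm_rcons.
Qed.

(* K is B with its row a replaced by the unit vector e_a; it is inverted by R, whose row v
   counts the vertices on the f-path from v to a.  Hence
   L + e_a^T e_a = K^T K + x^T x with x = B_a, and the determinant of the right-hand side is
   1 + |x R|^2. *)
Let B : 'M[int]_n := \matrix_(i, j) ((j == i)%:R - (j == f i)%:R).
Let K : 'M[int]_n := \matrix_(i, j) ((j == i)%:R - ((i != a) && (j == f i))%:R).
Let R : 'M[int]_n := \matrix_(i, j) (count_mem j (path_to i))%:R.

Let sum_delta (F : 'I_n -> int) i : \sum_j (j == i)%:R * F j = F i.
Proof.
rewrite (bigD1 i) //= eqxx mul1r big1 ?addr0 // => j /negPf ->; exact: mul0r.
Qed.

Let KR : K *m R = 1%:M.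
Proof.
apply/matrixP=> i j; rewrite !mxE.
transitivity (\sum_k ((k == i)%:R * R k j - (k == f i)%:R * ((i != a)%:R * R k j))).
  apply: eq_bigr => k _; rewrite !mxE mulrBl; congr (_ - _).
  by rewrite -mulnb natrM mulrCA mulrA.
rewrite sumrB !sum_delta !mxE; case: (eqVneq i a) => [->|ia].
  by rewrite mul0r subr0 /path_to d0 /= addn0 .
by rewrite mul1r /path_to dS //= natrD addrK.
Qed.

(** Row [w] of [B] is the signed incidence vector of the edge from [w] to [f w]. *)
Lemma laplacian_factor : laplacian h = B^T *m B.
Proof.
have [hE f1 f2] := hf.
apply/matrixP=> i j; rewrite !mxE (functional_deg hf) hE.
transitivity (\sum_w ((w == i)%:R * ((j == w)%:R - (j == f w)%:R)
   - (w == j)%:R * (i == f w)%:R + ((i == f w) && (j == f w))%:R : int)); last first.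
  apply: eq_bigr => w _; rewrite !mxE -mulnb natrM [w == i]eq_sym [w == j]eq_sym; ring.
rewrite big_split sumrB /= !sum_delta.
have -> : \sum_w ((i == f w) && (j == f w))%:R = (indeg f i)%:Z *+ (i == j) :> int.
  case: (eqVneq i j) => [->|ij]; last first.
    by rewrite big1 // => w _; case: eqP => // E1; case: eqP => // E2; rewrite E1 E2 eqxx in ij.
  rewrite /indeg -sum1dep_card (big_morph Posz PoszD (erefl _)) [RHS]big_mkcond.
  by apply: eq_bigr => w _; rewrite andbb eq_sym; case: eqP.
have disj : (j == f i) && (i == f j) = false.
  by apply/negP=> /andP[/eqP -> /eqP E]; have := f2 i; rewrite -E eqxx.
rewrite [j == i]eq_sym.
case: (eqVneq i j) disj => [->|_]; first by rewrite (eq_sym j) (negPf (f1 j)) => _ /=; lia.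
by case: (j == f i); case: (i == f j).
Qed.

Let detK2 : \det K ^+ 2 = 1.
Proof. by apply: (@int_square_unit _ (\det R)); rewrite -det_mulmx KR det1. Qed.

Lemma functional_cofactor : cofactor (laplacian h) a a = (order f a)%:Z.
Proof.
have det0 := laplacian_det0 a (functional_simple hf).1.
(* As the Laplacian is singular, its cofactor at [a] is the determinant after adding 1 to the
   diagonal entry at [a]. *)
rewrite -[LHS]add0r -{1}det0 -det_add_delta.
have -> : laplacian h + delta_mx a a = K^T *m (1%:M + (row a B *m R)^T *m (row a B *m R)) *m K.
  have RK : R *m K = 1%:M by apply: mulmx1C KR.
  rewrite mulmxDr mulmx1 mulmxDl trmx_mul -!mulmxA RK mulmx1 !mulmxA -trmx_mul RK trmx1 mul1mx.
  rewrite laplacian_factor; apply/matrixP=> i j; rewrite !mxE (bigD1 a) //= [in RHS](bigD1 a) //=.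
  rewrite big_ord1 !mxE eqxx subr0 addrAC [in RHS]addrAC; congr (_ + _).
    by rewrite addrC; congr (_ + _); case: eqP; case: eqP.
  by apply: eq_bigr => w /negPf wa; rewrite !mxE wa.
rewrite !det_mulmx det_tr mulrAC -expr2 detK2 mul1r det_1_addmx.
(* [x R] is [e_a] minus the indicator of the cycle: its entry at [a] cancels, and each other cycle
   vertex adds 1 to the squared norm. *)
have z j : (row a B *m R) 0 j = (j == a)%:R - (j \in orbit f a)%:R.
  rewrite -row_mul mxE mxE.
  transitivity (\sum_k ((k == a)%:R * R k j - (k == f a)%:R * R k j)).
    by apply: eq_bigr => k _; rewrite mxE mulrBl.
  rewrite sumrB !sum_delta !mxE (permP path_fa) (count_uniq_mem _ (orbit_uniq f a)).
  by rewrite /path_to d0 /= addn0 eq_sym.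
move: (row a B *m R) z => Z z; rewrite mxE.
transitivity (1 + \sum_(j | j != a) (j \in orbit f a)%:R : int).
  congr (_ + _); rewrite (bigD1 a) //= z eqxx in_orbit subrr mul0r add0r.
  apply: eq_bigr => j /negPf ja; rewrite !mxE !z ja sub0r mulrNN -natrM.
  by case: (_ \in _).
transitivity (\sum_j (j \in orbit f a)%:R : int).
  by rewrite [RHS](bigD1 a) //= in_orbit.
rewrite -natr_sum -natz; congr _%:R; rewrite -big_mkcond /= sum1_card -size_orbit.
exact/card_uniqP/orbit_uniq.
Qed.

(* The columns of the adjugate of -L are killed by B, hence constant; so its column a
   sums to n times the principal cofactor. *)
Lemma functional_char_poly1 :
  (char_poly (laplacian h))`_1 = (-1) ^+ n.-1 * (n * order f a)%:Z.
Proof.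
have sh := (functional_simple hf).1.
have BC v w : \adj (- laplacian h) v w = \adj (- laplacian h) a w.
  (* For a column [c] of the adjugate, [y^T y = c^T L c] vanishes because [L c] is a multiple of
     [det L = 0]; a zero sum of integer squares forces [y = 0]. *)
  pose y : 'cV_n := B *m col w (\adj (- laplacian h)).
  have : y^T *m y = 0.
    rewrite /y trmx_mul -mulmxA [B^T *m _]mulmxA -laplacian_factor colE [laplacian h *m _]mulmxA.
    have -> : laplacian h *m \adj (- laplacian h) = 0.
      apply: oppr_inj; rewrite oppr0 -mulNmx mul_mx_adj -scaleN1r detZ (laplacian_det0 a sh).
      by rewrite mulr0 raddf0.
    by rewrite mul0mx mulmx0.
  move/matrixP/(_ 0 0); rewrite !mxE => /eqP.
  rewrite psumr_eq0 => [/allP y0|u _]; last by rewrite mxE -expr2 sqr_ge0.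
  have step u : \adj (- laplacian h) u w = \adj (- laplacian h) (f u) w.
    have := y0 u (mem_index_enum _); rewrite mxE -expr2 sqrf_eq0 /y mxE.
    rewrite (eq_bigr (fun k => (k == u)%:R * \adj (- laplacian h) k w
       - (k == f u)%:R * \adj (- laplacian h) k w)) => [|k _].
      by rewrite sumrB !(sum_delta (fun k => \adj (- laplacian h) k w)) subr_eq0 => /eqP.
    by rewrite [B u k]mxE [col _ _ _ _]mxE mulrBl.
  have [m /eqP <-] := fa v; elim: m => //= m ->; have := step (iter m f v); by rewrite !mxE.
have one_ker : (const_mx 1 : 'rV_n) *m laplacian h = 0.
  by apply: laplacian_kernel => // i j; rewrite !mxE.
have /rowP/(_ a) := coef1_char_poly one_ker.
rewrite [X in X = _]mxE [X in _ * X = _]mxE mulr1 => E.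
rewrite E mxE.
rewrite (eq_bigr (fun=> (-1) ^+ n.-1 * (order f a)%:Z)) => [|v _].
  by rewrite sumr_const card_ord -mulr_natl PoszM natz mulrCA.
by rewrite mxE mul1r BC mxE cofactor_opp functional_cofactor.
Qed.

End CycleLength.

(** * Unicyclic graphs as graphs of self-maps *)

Lemma connect_parent (T : finType) (e : rel T) r : (forall v, connect e v r) ->
  exists (f : T -> T) (d : T -> nat), forall v, v != r -> e v (f v) /\ (d (f v) < d v)%N.
Proof.
(* The least [m] with [P v m] is the distance from [v] to [r]; the parent of [v] is a neighbour
   closer to [r], such as the second vertex of a shortest walk. *)
move=> er; pose P v m := [exists p : m.-tuple T, path e v p && (last v p == r)].
have exP v : exists m, P v m.
  have /connectP[p ep lp] := er v; exists (size p).
  by apply/existsP; exists (in_tuple p); rewrite ep -lp eqxx.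
pose d v := ex_minn (exP v).
have par v : v != r -> exists w, e v w && (d w < d v)%N.
  move=> vr; rewrite [d v]/d; case: ex_minnP => m /existsP[[p sp] /=].
  case: p sp => [|w p] /= sp; first by rewrite (negPf vr).
  move=> /andP[/andP[evw ep] lp] _; exists w; rewrite evw -(eqP sp) ltnS /=.
  rewrite /d; case: ex_minnP => k _; apply; apply/existsP.
  by exists (in_tuple p); rewrite ep.
exists (fun v => odflt v [pick w | e v w && (d w < d v)%N]), d => v /par[w ew].
by case: pickP => [u /andP[]|/(_ w)] //=; rewrite ew.
Qed.

Lemma descent_reaches n (f : 'I_n -> 'I_n) (d : 'I_n -> nat) a :
  (forall v, v != a -> d (f v) < d v)%N -> reaches f a.
Proof.
move=> fd v; have [m] := ubnP (d v); elim: m v => // m IH v dv.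
have [->|va] := eqVneq v a; first by exists 0%N; rewrite /= eqxx.
have [k fk] := IH (f v) (leq_trans (fd v va) dv).
by exists k.+1; rewrite iterSr.
Qed.

Lemma unicyclic_functional n (h : rel 'I_n) : (0 < n)%N -> simple_graph h ->
  (forall u v, connect h u v) -> (\sum_v #|[set k | h v k]| = n.*2)%N ->
  exists f a, functional h f /\ reaches f a.
Proof.
move=> n0 [sh ih] ch degs; pose r := Ordinal n0.
(* A spanning tree misses some edge (a, b); rooting a spanning tree of h - ab at a and
   sending a to b gives f. *)
pose E := [set p : 'I_n * 'I_n | h p.1 p.2].
have cE : #|E| = n.*2.
  rewrite -degs -sum1dep_card -(pair_big_dep predT h (fun _ _ => 1%N)) /=.
  by apply: eq_bigr => v _; rewrite sum1dep_card.
have [f [d fP]] := connect_parent (ch^~ r).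
(* The tree accounts for at most [2(n - 1)] ordered pairs, while [E] has [2n]. *)
have [[a b] abE ab_nontree] : exists2 p, p \in E &
    p \notin [set (v, f v) | v in [set~ r]] :|: [set (f v, v) | v in [set~ r]].
  apply/subsetPn/negP => /subset_leq_card; apply/negP; rewrite -ltnNge cE.
  apply: leq_ltn_trans (leq_card_setU _ _) _; rewrite -addnn.
  apply: (@leq_ltn_trans (#|[set~ r]| + #|[set~ r]|)).
    by rewrite leq_add // leq_imset_card.
  rewrite cardsC1 card_ord; lia.
rewrite inE /= in abE.
pose h' u v := [&& h u v, (u, v) != (a, b) & (u, v) != (b, a)].
have sh' : symmetric h'.
  move=> u v; rewrite /h' sh !xpair_eqE; congr (_ && _).
  by rewrite [RHS]andbC [(v == b) && _]andbC [(v == a) && _]andbC.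
(* No edge of the first tree is the removed one, so [h'] is still connected. *)
have ch'r v : connect h' v r.
  have [m] := ubnP (d v); elim: m v => // m IH v dv.
  have [->|vr] := eqVneq v r; first exact: connect0.
  have [hv dfv] := fP v vr.
  apply: connect_trans (IH (f v) (leq_trans dfv dv)); apply: connect1.
  rewrite /h' hv /=; apply/andP; split; apply: contraNneq ab_nontree.
    by move=> <-; rewrite inE imset_f // !inE.
  by move=> [<- <-]; rewrite inE orbC (imset_f (fun v => (f v, v))) // !inE.
have ch'a v : connect h' v a.
  by apply: connect_trans (ch'r v) _; rewrite (sym_connect_sym sh').
have [g' [d' gP]] := connect_parent ch'a.
pose g v := if v == a then b else g' v.
have ga : g a = b by rewrite /g eqxx.
have gv v : v != a -> h' v (g v) /\ (d' (g v) < d' v)%N.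
  by move=> va; have := gP v va; rewrite /g (negPf va).
have hg v : h v (g v).
  have [->|va] := eqVneq v a; first by rewrite ga.
  by have [/and3P[]] := gv v va.
have g1 v : g v != v by apply: contraTneq (hg v) => ->; rewrite ih.
(* If [g v = a], returning to [v] would make [v = b] and use the removed edge; otherwise [d'] drops
   twice. *)
have ggv v : v != a -> g (g v) != v.
  move=> va; have [h'v dv] := gv v va; have [gva|gva] := eqVneq (g v) a.
    rewrite gva ga; apply: contraTneq h'v => bv.
    by rewrite /h' gva -bv eqxx !andbF.
  have [_ dgv] := gv (g v) gva; apply: contraTneq dgv => ->.
  by rewrite -leqNgt ltnW.
have g2 v : g (g v) != v.
  have [->|] := eqVneq v a; last exact: ggv.
  by apply/negP => /eqP gga; have := ggv (g a); rewrite gga eqxx => /(_ (g1 a)).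
exists g, a; split; last by apply: (@descent_reaches _ _ d') => v /gv[].
split=> // u v.
(* The pairs [(v, g v)] and their reverses are [2n] distinct members of [E], so they exhaust it. *)
pose F1 := [set (v, g v) | v in 'I_n]; pose F2 := [set (g v, v) | v in 'I_n].
have FE : F1 :|: F2 = E.
  apply/eqP; rewrite eqEcard; apply/andP; split.
    by apply/subsetP=> p; rewrite inE => /orP[] /imsetP[w _ ->]; rewrite inE //= sh.
  have F12 : F1 :&: F2 = set0.
    apply/setP=> p; rewrite !inE; apply/negP => /andP[/imsetP[w _ ->] /imsetP[x _ [-> E1]]].
    by have := g2 x; rewrite E1 eqxx.
  rewrite cE cardsU F12 cards0 subn0 !card_imset ?card_ord ?addnn // => x y [] //.
have -> : h u v = ((u, v) \in E) by rewrite inE.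
rewrite -FE inE; congr (_ || _); apply/imsetP/eqP => [[w _ [-> ->]] //|->].
  by exists u.
by exists v.
Qed.

(** If [v] lies outside the component of [u], the indicator of the complement of that component is a
    kernel vector vanishing at [u], so all cofactors along row [u] are 0. The indicator of the
    component itself then extracts coefficient 1 as a combination of these cofactors. *)
Lemma char_poly1_connected n (h : rel 'I_n) : simple_graph h ->
  (char_poly (laplacian h))`_1 != 0 -> forall u v, connect h u v.
Proof.
move=> [sh ih] c1 u v; apply: contraNT c1 => nuv.
pose comp (b : bool) : 'rV[int]_n := \row_w (connect h u w == b)%:R.
have comp_ker b : comp b *m laplacian h = 0.
  apply: laplacian_kernel => // i j hij; rewrite !mxE.
  by rewrite (same_connect_r (sym_connect_sym sh) (connect1 hij)).
have cof0 w : cofactor (- laplacian h) u w = 0.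
  apply: (@cofactor_kernel0 _ _ _ (comp false)).
  - by rewrite mulmxN comp_ker oppr0.
  - by apply/eqP=> /rowP/(_ v); rewrite !mxE (negPf nuv).
  - by rewrite mxE connect0.
have /rowP/(_ u) := coef1_char_poly (comp_ker true).
rewrite [X in X = _]mxE [X in _ * X = _]mxE connect0 mulr1 => ->.
by apply/eqP; rewrite mxE big1 // => w _; rewrite [\adj _ _ _]mxE cof0 mulr0.
Qed.

(** * Iterates and periods of a map all of whose orbits reach one point *)

Section ReachedCycle.
Variables (n : nat) (f : 'I_n -> 'I_n) (a : 'I_n).
Hypothesis fa : reaches f a.

(** Since [a] is an iterate of [u], any period of [u] is also a period of [a]. *)
Lemma iter_reached_neq k u : (0 < k < order f a)%N -> iter k f u != u.
Proof.
move=> /andP[k0 ka]; apply/negP => /eqP fku; have [m /eqP fm] := fa u.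
have fka : iter k f a = a by rewrite -{1}fm -iterD addnC iterD fku.
by move: k0; rewrite -(findex_iter ka) fka findex0.
Qed.

Lemma iter_reached_mod k : iter (k %% order f a) f a = iter k f a.
Proof.
rewrite {2}(divn_eq k (order f a)) addnC iterD; congr iter.
by elim: (k %/ _)%N => // j IH; rewrite mulSn iterD -IH (reached_periodic fa).
Qed.

Lemma reached_inj : {in orbit f a &, injective f}.
Proof. by apply/(orbitPcycle 4 5); apply: reached_periodic. Qed.

End ReachedCycle.

(** * The jellyfish graph as the graph of a self-map *)

Section Jellyfish.
Variables (p q : nat).
Hypothesis q4 : (4 <= q)%N.

Let q0 : (0 < q)%N := ltn_trans (isT : 0 < 3)%N q4.

Lemma jfg_next_subproof (x : 'I_(q * p.+1)) :
  ((if x %% p.+1 == 0 then (x %/ p.+1).+1 %% q else x %/ p.+1) * p.+1 < q * p.+1)%N.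
Proof. by rewrite ltn_pmul2r //; case: ifP; rewrite ?ltn_mod ?ltn_divLR. Qed.

Definition jfg_next x := Ordinal (jfg_next_subproof x).

Lemma jfg_size_gt0 : (0 < q * p.+1)%N.
Proof. by rewrite muln_gt0 q0. Qed.

Definition jfg_root := Ordinal jfg_size_gt0.

Let val_eq_center (x : nat) c : (x == c * p.+1)%N = (x %% p.+1 == 0)%N && (x %/ p.+1 == c)%N.
Proof.
apply/eqP/andP => [->|[/eqP x0 /eqP <-]]; first by rewrite modnMl mulnK.
by rewrite {1}(divn_eq x p.+1) x0 addn0.
Qed.

Let center_lt (x : 'I_(q * p.+1)) : (x %/ p.+1 < q)%N.
Proof. by rewrite ltn_divLR. Qed.

Lemma jfg_iter k : val (iter k jfg_next jfg_root) = ((k %% q) * p.+1)%N.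
Proof.
elim: k => [|k IH]; first by rewrite mod0n.
by rewrite iterS /= IH modnMl mulnK //= -[in LHS]addn1 modnDml addn1.
Qed.

Lemma jfg_reaches : reaches jfg_next jfg_root.
Proof.
have center c : (c < q)%N -> exists m, forall x, val x = (c * p.+1)%N -> iter m jfg_next x == jfg_root.
  move=> cq; exists (q - c)%N => x xc.
  have -> : x = iter c jfg_next jfg_root by apply: val_inj; rewrite jfg_iter modn_small.
  by rewrite -iterD subnK ?(ltnW cq) // -val_eqE jfg_iter modnn.
move=> x; set y := jfg_next x.
have [m my] : exists m, iter m jfg_next y == jfg_root.
  have cq : ((if x %% p.+1 == 0 then (x %/ p.+1).+1 %% q else x %/ p.+1) < q)%N.
    by case: ifP; rewrite ?ltn_mod.
  by have [m my] := center _ cq; exists m; apply: my.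
by exists m.+1; rewrite iterSr.
Qed.

Lemma jfg_order : order jfg_next jfg_root = q.
Proof.
apply/eqP; rewrite eqn_leq; apply/andP; split; last first.
  apply: dvdn_leq; first exact: order_gt0.
  have /(congr1 val) := reached_periodic jfg_reaches; rewrite jfg_iter /= => /eqP.
  by rewrite muln_eq0 orbF.
rewrite leqNgt; apply/negP=> q_lt.
have /negP[] := @iter_reached_neq _ _ _ jfg_reaches q jfg_root (introT andP (conj q0 q_lt)).
by rewrite -val_eqE jfg_iter modnn.
Qed.

Lemma jfg_functional : functional (jfg_rel p q) jfg_next.
Proof.
split=> [u v|u|u].
- rewrite -[v == _]val_eqE -[u == _]val_eqE /= !val_eq_center /jfg_rel.
  rewrite [(u %/ _ == v %/ _)%N]eq_sym.
  by case: (_ %% _ == 0)%N; case: (_ %% _ == 0)%N; rewrite //= ?orbF.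
- by apply: (@iter_reached_neq _ _ _ jfg_reaches 1); rewrite jfg_order (ltn_trans _ q4).
- by apply: (@iter_reached_neq _ _ _ jfg_reaches 2); rewrite jfg_order (ltn_trans _ q4).
Qed.

Lemma jfg_indeg_leaf (x : 'I_(q * p.+1)) : (x %% p.+1 != 0)%N -> indeg jfg_next x = 0%N.
Proof.
move=> x0; apply: eq_card0 => w; rewrite !inE; apply/negP=> /eqP wx.
by rewrite -wx /= modnMl eqxx in x0.
Qed.

Lemma jfg_indeg_center (x : 'I_(q * p.+1)) : (x %% p.+1 == 0)%N -> indeg jfg_next x = p.+1.
Proof.
move=> x0; pose c := (x %/ p.+1)%N.
have xc : val x = (c * p.+1)%N by apply/eqP; rewrite val_eq_center x0 eqxx.
(* The preimages of centre [c], indexed by residue: residue 0 is the previous centre, with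
   [c + q.-1] standing for [c - 1] modulo [q]; the other residues are the leaves of block [c]. *)
have bound (j : 'I_p.+1) : ((if j == 0 :> nat then (c + q.-1) %% q else c) * p.+1 + j < q * p.+1)%N.
  have : ((if j == 0 :> nat then (c + q.-1) %% q else c) < q)%N.
    by case: ifP; rewrite ?ltn_mod // center_lt.
  move: (if _ then _ else _) => e eq; apply: leq_trans (_ : e.+1 * p.+1 <= _)%N.
    by rewrite mulSn addnC ltn_add2r.
  by rewrite leq_pmul2r.
pose g j := Ordinal (bound j).
have g_inj : injective g.
  move=> i j /(congr1 val) /= /(congr1 (modn^~ p.+1)).
  by rewrite !modnMDl !modn_small // => /val_inj.
rewrite -[RHS]card_ord -(card_codom g_inj) /indeg; apply: eq_card => w; rewrite inE.
apply/eqP/codomP => [wx|[j ->]]; last first.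
  apply: val_inj; rewrite /= xc modnMDl divnMDl // modn_small // divn_small // addn0.
  case: (nat_of_ord j == 0)%N => //; congr (_ * _)%N; rewrite -addn1 modnDml -addnA addn1 prednK // modnDr modn_small //.
  exact: center_lt.
exists (Ordinal (ltn_pmod w (isT : 0 < p.+1)%N)); apply: val_inj => /=.
rewrite [LHS](divn_eq w p.+1); congr (_ * _ + _)%N.
have {wx} := congr1 (fun y : 'I__ => y %/ p.+1)%N wx; rewrite /= mulnK // -/c => <-.
case: (w %% p.+1 == 0)%N => //; have := center_lt w; move: (w %/ _)%N => d dq.
by rewrite modnDml addSnnS prednK // modnDr modn_small.
Qed.

End Jellyfish.

(** * Recognising the jellyfish graph from its in-degrees *)

Lemma jellyfish_shape_iso p q (q4 : (4 <= q)%N) (h : rel 'I_(q * p.+1)) f a :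
  functional h f -> reaches f a -> order f a = q ->
  (forall v, indeg f v = 0 \/ indeg f v = p.+1)%N -> graph_iso (jfg_rel p q) h.
Proof.
move=> hf fa ord_q degs.
have q0 : (0 < q)%N by apply: ltn_trans q4.
have per : iter q f a = a by have := reached_periodic fa; rewrite ord_q.
pose C := orbit f a; pose s c := iter c f a.
have sC c : s c \in C by rewrite -fconnect_orbit fconnect_iter.
have s_mod c : s (c %% q)%N = s c by have := iter_reached_mod fa c; rewrite ord_q.
have s_inj c c' : (c < q)%N -> (c' < q)%N -> s c = s c' -> c = c'.
  by move=> cq cq' /(congr1 (findex f a)); rewrite !findex_iter ?ord_q.
have indegC v : v \in C -> indeg f v = p.+1.
  move=> vC; case: (degs v) => // /eqP; rewrite cards_eq0 => /eqP/setP.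
  have [w wC wv] : exists2 w, w \in C & f w = v.
    have [c /eqP fc] := fa v; have vE := iter_findex (eq_trans (fconnect_orbit _ _ _) vC).
    exists (s (findex f a v + q.-1)%N); rewrite // /s -iterS -addnS prednK //.
    by rewrite iterD per.
  by move/(_ w); rewrite !inE wv eqxx.
(* The [q] cycle vertices already receive [q * p.+1] arrows, which is all of them. *)
have indegNC v : v \notin C -> indeg f v = 0%N.
  move=> vC; have := sum_indeg f; rewrite (bigID (mem C)) /=.
  rewrite (eq_bigr (fun=> p.+1)) => [|w /indegC //]; rewrite sum_nat_const.
  rewrite (card_uniqP (orbit_uniq f a)) size_orbit ord_q => /eqP.
  rewrite -[X in _ == X]addn0 eqn_add2l sum_nat_eq0 => /forallP/(_ v).
  by rewrite vC => /eqP.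
pose leaves c := enum [set w | (f w == s c) && (w \notin C)].
have leavesP c w : (w \in leaves c) = (f w == s c) && (w \notin C).
  by rewrite mem_enum inE.
have size_leaves c : size (leaves c) = p.
  rewrite -cardE; have := indegC _ (sC c).
  (* Of the [p.+1] preimages of [s c], exactly one, its predecessor [s (c + q.-1)], is on the
     cycle. *)
  rewrite /indeg (cardsD1 (s (c + q.-1)%N)).
  have fs : f (s (c + q.-1)%N) = s c.
    by rewrite /s -iterS -addnS prednK // iterD per.
  rewrite inE fs eqxx add1n => -[degE]; apply: etrans degE; apply: eq_card => w; rewrite !inE.
  case: (f w =P s c) => fw; rewrite ?andbF //= andbT.
  apply/idP/idP; first by apply: contraNneq => ->; exact: sC.
  apply: contraNN => wC; apply/eqP.
  by apply: (reached_inj fa); rewrite ?fw ?fs //; apply: sC.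
(* Block [c] goes to [s c] followed by its leaves. The list has length [p.+1], so the default [a] is
   never returned. *)
pose g (x : 'I_(q * p.+1)) := nth a (s (x %/ p.+1)%N :: leaves (x %/ p.+1)%N) (x %% p.+1).
have center_lt (x : 'I_(q * p.+1)) : (x %/ p.+1 < q)%N by rewrite ltn_divLR.
have g_center (x : 'I_(q * p.+1)) : (x %% p.+1 == 0)%N -> g x = s (x %/ p.+1)%N by rewrite /g => /eqP ->.
have g_leaf (x : 'I_(q * p.+1)) : (x %% p.+1 != 0)%N -> f (g x) = s (x %/ p.+1)%N /\ g x \notin C.
  rewrite /g; case E: (x %% p.+1)%N => [|k] //= _.
  have: nth a (leaves (x %/ p.+1)%N) k \in leaves (x %/ p.+1)%N.
    by rewrite mem_nth // size_leaves -ltnS -E ltn_pmod.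
  by rewrite leavesP => /andP[/eqP].
have g_inj : injective g.
  move=> x y gxy; apply: ord_inj; rewrite [LHS](divn_eq x p.+1) [RHS](divn_eq y p.+1).
  have [x0|x0] := boolP (x %% p.+1 == 0)%N; have [y0|y0] := boolP (y %% p.+1 == 0)%N.
  - rewrite (eqP x0) (eqP y0) !addn0; congr (_ * _)%N; apply: s_inj => //.
    by rewrite -!g_center.
  - by have [_ /negP[]] := g_leaf y y0; rewrite -gxy g_center.
  - by have [_ /negP[]] := g_leaf x x0; rewrite gxy g_center.
  have [fx _] := g_leaf x x0; have [fy _] := g_leaf y y0.
  have cxy : (x %/ p.+1 = y %/ p.+1)%N by apply: s_inj => //; rewrite -fx -fy gxy.
  rewrite cxy; congr (_ + _)%N; move: gxy; rewrite /g cxy.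
  have := ltn_pmod x (isT : 0 < p.+1)%N; have := ltn_pmod y (isT : 0 < p.+1)%N.
  case: (x %% _)%N x0 => // k _; case: (y %% _)%N y0 => // l _ lp kp /= /eqP.
  by rewrite nth_uniq ?size_leaves ?enum_uniq // => /eqP ->.
have g_conj x : g (jfg_next q4 x) = f (g x).
  have f0 : (jfg_next q4 x %% p.+1 == 0)%N by rewrite /= modnMl.
  rewrite (g_center _ f0) /= mulnK //; case: ifP => [x0|/negbT x0].
    by rewrite s_mod (g_center _ x0).
  by have [] := g_leaf x x0.
exists g; split; first exact: inj_card_bij.
move=> x y; have [-> _ _] := hf; have [-> _ _] := @jfg_functional p q q4.
by rewrite -!g_conj !(inj_eq g_inj).
Qed.

Lemma graph_iso_sym n m (e : rel 'I_n) (e' : rel 'I_m) : graph_iso e e' -> graph_iso e' e.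
Proof.
move=> [g [[g' gK g'K] ge]]; exists g'; split; first by exists g.
by move=> i j; rewrite -ge !g'K.
Qed.

Lemma graph_iso_trans n m l (e : rel 'I_n) (e' : rel 'I_m) (e'' : rel 'I_l) :
  graph_iso e e' -> graph_iso e' e'' -> graph_iso e e''.
Proof.
move=> [g [bg ge]] [g' [bg' ge']]; exists (g' \o g); split; first exact: bij_comp.
by move=> i j; rewrite /= ge' ge.
Qed.

(** * Cospectral mates of the jellyfish graph *)

Lemma functional_trace3 n (h : rel 'I_n) f a : functional h f -> reaches f a ->
  (4 <= order f a)%N -> \tr (laplacian h *m laplacian h *m laplacian h) =
  \sum_i ((#|[set k | h i k]|%:Z) ^+ 3 + 3 * (#|[set k | h i k]|%:Z) ^+ 2).
Proof.
move=> hf fa ord4; rewrite (laplacian_trace3 (functional_simple hf)).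
rewrite (functional_trianglefree hf) ?subr0 // => u.
exact: (@iter_reached_neq _ _ _ fa 3).
Qed.

Lemma jfg_cospectral_iso p q n (h : rel 'I_n) : (4 <= q)%N -> simple_graph h ->
  L_cospectral h (jfg_rel p q) -> graph_iso (jfg_rel p q) h.
Proof.
move=> q4 sh cosp; have := congr1 (fun r : {poly int} => size r) cosp.
rewrite !size_char_poly => -[En]; subst n; pose N := (q * p.+1)%N.
have N0 : (0 < N)%N := @jfg_size_gt0 p q q4.
have jf := @jfg_functional p q q4; have jr := @jfg_reaches p q q4; have jo := @jfg_order p q q4.
have js := functional_simple jf.
have j1 := functional_char_poly1 jf jr; rewrite jo in j1.
have [t1 t2 t3] := cospectral_traces (laplacian_sym sh.1) (laplacian_sym js.1) cosp.
have sum_deg : \sum_v #|[set k | h v k]|%:Z = (N.*2)%:Z.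
  by rewrite -laplacian_trace ?t1 ?laplacian_trace ?(functional_tracesum jf) //; case: sh js => [? ?] [].
have conn : forall u v, connect h u v.
  apply: char_poly1_connected => //; rewrite cosp j1 mulf_eq0 signr_eq0 /=.
  by rewrite eqz_nat muln_eq0 negb_or -!lt0n N0 (ltn_trans _ q4).
have [f [a [hf fa]]] : exists f a, functional h f /\ reaches f a.
  apply: unicyclic_functional => //; apply/eqP; rewrite -eqz_nat.
  by rewrite (big_morph Posz PoszD (erefl _)) sum_deg.
have ord_q : order f a = q.
  have := functional_char_poly1 hf fa; rewrite cosp j1 => /(mulfI _).
  by rewrite signr_eq0 => /(_ isT) [] /eqP; rewrite eqn_pmul2l // => /eqP/esym.
apply: (jellyfish_shape_iso q4 hf fa ord_q) => v.
pose m : int := p.+2%:Z.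
pose dev (d : int) := (d - 1) * (d - m) ^+ 2.
(* The coefficients rewrite the cubic [dev d] in terms of [d^3 + 3 d^2], [d^2 + d], [d] and 1, the
   summands of the three traces and the constant. *)
have dev_sum g (e : rel 'I_(q * p.+1)) b : functional e g -> reaches g b -> order g b = q ->
   \sum_i dev #|[set k | e i k]|%:Z =
   \tr (laplacian e *m laplacian e *m laplacian e)
   - (2 * m + 4) * \tr (laplacian e *m laplacian e)
   + (m + 2) ^+ 2 * \tr (laplacian e) - N%:Z * m ^+ 2.
  move=> eg gb gq; have se := functional_simple eg.
  rewrite (functional_trace3 eg gb) ?gq // laplacian_trace2 // laplacian_trace; last exact: se.2.
  have -> : N%:Z * m ^+ 2 = \sum_(i < N) m ^+ 2.
    by rewrite sumr_const card_ord -mulr_natl natz.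
  rewrite !mulr_sumr -sumrB -big_split -sumrB /=; apply: eq_bigr => i _.
  by rewrite /dev; ring.
have : \sum_i dev #|[set k | h i k]|%:Z = 0.
  rewrite (dev_sum _ _ _ hf fa ord_q) t1 t2 t3 -(dev_sum _ _ _ jf jr jo).
  apply: big1 => i _; rewrite (functional_deg jf) /dev.
  have [/jfg_indeg_center-> | /jfg_indeg_leaf->] := boolP (i %% p.+1 == 0)%N.
    by rewrite subrr expr0n mulr0.
  by rewrite subrr mul0r.
(* Degrees are in-degrees plus one, hence at least 1; every summand is nonnegative and so vanishes
   separately. *)
move/eqP; rewrite psumr_eq0 => [/allP/(_ v (mem_index_enum _))|i _]; last first.
  by rewrite /dev (functional_deg hf) mulr_ge0 ?sqr_ge0 //; lia.
rewrite /dev (functional_deg hf) mulf_eq0 sqrf_eq0 /m /= => /orP[] /eqP; lia.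
Qed.

Theorem theorem3p3 (p q : nat) : (1 <= p)%N -> (4 <= q)%N -> ~~ odd q ->
  forall (n : nat) (h : rel 'I_n), simple_graph h ->
    L_cospectral h (jfg_rel p q) -> DLS h.
Proof.
move=> _ q4 _ n h sh hj m f sf fh.
(* Both [h] and its mate [f] are cospectral to the jellyfish graph, hence isomorphic to it and to
   each other. *)
apply: graph_iso_trans (jfg_cospectral_iso q4 sh hj).
apply: graph_iso_sym; apply: jfg_cospectral_iso => //.
by rewrite /L_cospectral fh.
Qed.
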